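(* Every uncountable abelian Polish group $G$ contains a strongly invisible (nonempty) compact set; that is, there is a nonempty compact set $C\subseteq G$ such that for every translation invariant Borel measure $\mu$ on $G$, either $\mu(C)=0$ or $C$ is not $\sigma$-finite with respect to $\mu$.
   Context: A Polish group is a topological group whose topology is Polish (separable and completely metrizable). A translation invariant Borel measure on $G$ is a countably additive measure $\mu$ on the Borel sets of $G$ with values in $[0,\infty]$ (not assumed $\sigma$-finite) such that $\mu(A+g)=\mu(A)$ for all Borel $A\subseteq G$ and all $g\in G$. A Borel set $M$ is $\sigma$-finite with respect to $\mu$ if it is a countable union of Borel sets of finite $\mu$-measure. A Borel set $M\subseteq G$ is strongly invisible if for every translation invariant Borel measure $\mu$ on $G$, $\mu(M)=0$ or $M$ is not $\sigma$-finite with respect to $\mu$. *)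

(* Defs.v *)
From HB Require Import structures.
From mathcomp Require Import all_boot all_order all_algebra.
From mathcomp Require Import all_classical all_reals all_analysis.
Set Implicit Arguments.
Unset Strict Implicit.
Unset Printing Implicit Defensive.
Import Order.TTheory GRing.Theory Num.Theory.

Local Open Scope classical_set_scope.
Local Open Scope ring_scope.

Definition separable (T : topologicalType) : Prop :=
  exists2 D : set T, countable D & dense D.

Definition is_metric (R : realType) (T : Type) (d : T -> T -> R) : Prop :=
  [/\ forall x y, 0 <= d x y,
      forall x y, d x y = 0 <-> x = y,
      forall x y, d x y = d y x &
      forall x y z, d x z <= d x y + d y z].

Definition metric_induces_topology (R : realType) (T : topologicalType)
    (d : T -> T -> R) : Prop :=
  forall (x : T) (A : set T),
    nbhs x A <-> exists2 e : R, 0 < e & [set y | d x y < e] `<=` A.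

Definition cauchy_sequence (R : realType) (T : Type) (d : T -> T -> R)
    (u : nat -> T) : Prop :=
  forall e : R, 0 < e ->
    exists N : nat, forall m n : nat, (N <= m)%N -> (N <= n)%N ->
      d (u m) (u n) < e.

Definition completely_metrizable (R : realType) (T : topologicalType) : Prop :=
  exists d : T -> T -> R,
    [/\ is_metric d, metric_induces_topology d &
        forall u : nat -> T, cauchy_sequence d u ->
          exists l : T, u @ \oo --> l].

Definition polish (R : realType) (T : topologicalType) : Prop :=
  separable T /\ completely_metrizable R T.

(* [g_sigma_algebraType] requires a pointed carrier, which a
   [topologicalZmodType] is not: this copy of G is pointed at 0. *)
Definition pointed_copy (G : topologicalZmodType) : Type := G.

HB.instance Definition _ (G : topologicalZmodType) :=
  Choice.on (pointed_copy G).
HB.instance Definition _ (G : topologicalZmodType) :=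
  isPointed.Build (pointed_copy G) (0 : G).

Notation borelType G :=
  (g_sigma_algebraType (@open G : set (set (pointed_copy G)))).

Definition translation_invariant (R : realType) (G : topologicalZmodType)
    (mu : {measure set (borelType G) -> \bar R}) : Prop :=
  forall (A : set G) (g : G), measurable (A : set (borelType G)) ->
    mu [set x + g | x in A] = mu A.

Definition strongly_invisible (R : realType) (G : topologicalZmodType)
    (M : set G) : Prop :=
  measurable (M : set (borelType G)) /\
  forall mu : {measure set (borelType G) -> \bar R},
    translation_invariant mu ->
    mu M = 0%E \/ ~ sigma_finite (M : set (borelType G)) mu.

(* Main.v *)
(* A Cantor scheme yields digits g_n in G such that phi x = \sum_(n | x n) g_n is
   continuous and injective on the Cantor space, and additive on sequences with
   disjoint supports. Split the coordinates into the infinite classes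
   {n | logn 2 n = k}, and let C be the image of the sequences x whose support,
   if nonempty with least element m, only meets the classes k <= m. Near 0 the set C
   gets ever richer: let T_m be the image of the sequences supported in
   {n > m | logn 2 n <= m}. Then C is covered by the T_m and g_m + T_m. But filling
   in the coordinates of class m.+1 shows that C contains uncountably many pairwise
   disjoint translates of T_m, so if C is sigma-finite every T_m is null, and so
   is C. *)
Require Import Defs.
From mathcomp Require Import all_boot all_order all_algebra.
From mathcomp Require Import all_classical all_reals all_analysis.
From mathcomp Require Import lra.
Import Order.TTheory GRing.Theory Num.Theory.

Local Open Scope classical_set_scope.
Local Open Scope ring_scope.

(** * Topological preliminaries *)

Lemma metric_hausdorff (R : realType) (T : topologicalType) (d : T -> T -> R) :
  is_metric d -> metric_induces_topology d -> hausdorff_space T.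
Proof.
move=> [d_ge0 d_eq0 d_sym d_tri] dT p q pq; apply: contrapT => p_neq_q.
have d0 : 0 < d p q.
  by rewrite lt0r d_ge0 andbT; apply/eqP => /d_eq0.
have ball_nbhs x : nbhs x [set y | d x y < d p q / 2].
  by apply/dT; exists (d p q / 2) => //; rewrite divr_gt0.
have [r [/= pr qr]] := pq _ _ (ball_nbhs p) (ball_nbhs q).
by have := d_tri p r q; rewrite (d_sym r q); lra.
Qed.

Lemma addr_continuous (G : topologicalZmodType) (g : G) :
  continuous (fun x : G => x + g).
Proof.
move=> x; apply: (@continuous_comp _ _ _ (fun x => (x, g))
  (fun x : G * G => x.1 + x.2)); last exact: add_continuous.
by apply: cvg_pair; [exact: cvg_id|exact: cvg_cst].
Qed.

(** Translations carry the open singleton at 0 to every point, and a dense set meets every open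
    singleton. *)
Lemma separable_discrete_countable (G : topologicalZmodType) :
  separable G -> nbhs (0 : G) [set 0] -> countable [set: G].
Proof.
move=> [D cD dD] n0; apply: sub_countable cD; apply: subset_card_le => x _.
have nx (y : G) : nbhs y [set y].
  have : nbhs y ((fun z => z - y) @^-1` [set 0]).
    by apply: addr_continuous; rewrite subrr.
  by apply: filterS => z /= /eqP; rewrite subr_eq0 => /eqP.
have ox : open [set x].
  by rewrite openE => y /= ->; exact: nx.
by have [y [/= -> ]] := dD [set x] (ex_intro _ x erefl) ox.
Qed.

Lemma seq_gt0_lbound (R : realType) (I : eqType) (s : seq I) (f : I -> R) :
  {in s, forall i, 0 < f i} ->
  exists2 e : R, 0 < e & {in s, forall i, e <= f i}.
Proof.
elim: s => [|a s IH] fs; first by exists 1.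
have [|e e0 es] := IH; first by move=> i si; apply: fs; rewrite inE si orbT.
exists (Num.min e (f a)).
  by rewrite lt_min e0 fs // mem_head.
move=> i; rewrite inE => /predU1P[->|/es]; first by rewrite ge_min lexx orbT.
by move=> ei; rewrite ge_min ei.
Qed.

(** * Choice of the digits and their partial sums *)

Section PartialSums.
Context {V : zmodType} (g : nat -> V).

Definition psum (x : nat -> bool) (n : nat) : V :=
  \sum_(i < n) if x i then g i else 0.

Lemma psumS x n : psum x n.+1 = psum x n + if x n then g n else 0.
Proof. by rewrite /psum big_ord_recr. Qed.

Lemma eq_psum x y n : (forall i, (i < n)%N -> x i = y i) -> psum x n = psum y n.
Proof. by move=> xy; apply: eq_bigr => i _; rewrite xy. Qed.

Lemma psum_or x y n : (forall i, ~~ (x i && y i)) ->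
  psum (fun i => x i || y i) n = psum x n + psum y n.
Proof.
move=> xy; rewrite /psum -big_split; apply: eq_bigr => i _ /=.
by have := xy i; case: (x i); case: (y i) => //=; rewrite (addr0, add0r).
Qed.

End PartialSums.

(* [S] is the finite set of sums of the digits chosen so far, and [e] the room
   left for all the later ones. *)
Lemma next_digit (R : realType) (G : topologicalZmodType) (d : G -> G -> R)
    (S : seq G) (e : R) :
  is_metric d -> metric_induces_topology d -> ~ nbhs (0 : G) [set 0] -> 0 < e ->
  exists (g : G) (e' : R), let S' := S ++ [seq s + g | s <- S] in
    [/\ g != 0, 0 < e' <= e / 2, {in S, forall s, d s (s + g) < e} &
        {in S' &, forall s t, s != t -> 6 * e' <= d s t}].
Proof.
move=> [d_ge0 d_eq0 d_sym d_tri] dT n0 e0.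
have [g g0 gS] : exists2 g : G, g != 0 & {in S, forall s, d s (s + g) < e}.
  (* Since S is finite, the suitable g form a neighbourhood of 0. If 0 were the only one, the
     topology would be discrete at 0. *)
  have : nbhs (0 : G) [set g | {in S, forall s, d s (s + g) < e}].
    elim: S => [|a S IH]; first by apply: filterS filterT.
    have : nbhs (0 : G) ((fun x => x + a) @^-1` [set y | d a y < e]).
      apply: addr_continuous; rewrite add0r; apply/dT.
      by exists e.
    move: IH; apply: filterS2 => g gS /= ga s.
    by rewrite inE => /predU1P[->|/gS //]; rewrite addrC.
  move=> nS; apply: contrapT => noG; apply: n0.
  apply: filterS nS => g gS /=; apply/eqP.
  by apply: contra_notT noG => g0; exists g.
pose S' := S ++ [seq s + g | s <- S].
have [|e1 e10 e1S] := seq_gt0_lbound R _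
    [seq p <- [seq (s, t) | s <- S', t <- S'] | p.1 != p.2]
    (fun p => d p.1 p.2).
  move=> p; rewrite mem_filter => /andP[/eqP p12 _].
  by rewrite lt0r d_ge0 andbT; apply/eqP => /d_eq0.
(* Halving keeps the later digits summable. The factor 6 will absorb two limit errors below 3 * e',
   one for each of two sequences to be told apart. *)
exists g, (Num.min (e / 2) (e1 / 6)); split=> //.
  by rewrite ge_min lexx /= lt_min !divr_gt0.
move=> s t sS tS st; apply: (@le_trans _ _ e1).
  have : Num.min (e / 2) (e1 / 6) <= e1 / 6 by rewrite ge_min lexx orbT.
  lra.
by apply: (e1S (s, t)); rewrite mem_filter /= st; exact: allpairs_f.
Qed.

(** Iterates [next_digit] from the list of sums [[:: 0]] and room 1. The n-th list contains
    [psum g x n] for every x, so the bounds are uniform in x. *)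
Lemma digit_sequence (R : realType) (G : topologicalZmodType)
    (d : G -> G -> R) :
  is_metric d -> metric_induces_topology d -> ~ nbhs (0 : G) [set 0] ->
  exists (g : nat -> G) (e : nat -> R),
    [/\ forall n, g n != 0, forall n, 0 < e n,
        e 0%N = 1 /\ forall n, e n.+1 <= e n / 2,
        forall x n, d (psum g x n) (psum g x n + g n) < e n &
        forall x y n, psum g x n.+1 != psum g y n.+1 ->
          6 * e n.+1 <= d (psum g x n.+1) (psum g y n.+1)].
Proof.
move=> dm dT n0.
(* The guard [0 < p.2] makes [step] total, as dependent choice demands; [f_gt0] then discharges it
   along the sequence. *)
pose step (p q : seq G * R) := 0 < p.2 -> exists g : G,
  let S' := p.1 ++ [seq s + g | s <- p.1] in
    [/\ g != 0, q.1 = S', 0 < q.2 <= p.2 / 2,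
      {in p.1, forall s, d s (s + g) < p.2} &
      {in S' &, forall s t, s != t -> 6 * q.2 <= d s t}].
have step_ex p : {q | step p q}.
  apply: cid; have [p0|p0] := boolP (0 < p.2); last first.
    by exists p => p0'; move: p0; rewrite p0'.
  have [g [e [g0 e0 gs es]]] := next_digit R G d p.1 p.2 dm dT n0 p0.
  by exists (p.1 ++ [seq s + g | s <- p.1], e) => _; exists g.
have [f [f0 fS]] := dependent_choice step_ex ([:: 0], 1).
have f_gt0 n : 0 < (f n).2.
  elim: n => [|n IH]; first by rewrite f0.
  by have [g [_ _ /andP[]]] := fS n IH.
have [g gP] := choice (fun n => fS n (f_gt0 n)).
have psum_in x n : psum g x n \in (f n).1.
  elim: n => [|n IH]; first by rewrite f0 /psum big_ord0 mem_head.
  have [_ -> _ _ _] := gP n; rewrite psumS mem_cat.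
  case: (x n); last by rewrite addr0 IH.
  by rewrite (map_f (fun s => s + g n)) ?orbT.
exists g, (fun n => (f n).2); split=> //.
- by move=> n; case: (gP n).
- by split=> [|n]; [rewrite f0|have [_ _ /andP[]] := gP n].
- by move=> x n; have [_ _ _ + _] := gP n; apply.
move=> x y n; have [_ Sn _ _ sep] := gP n.
by apply: sep => //; rewrite -Sn.
Qed.

(** * Embedding of the Cantor space *)

Lemma nbhs_cantor_prefix (x : cantor_space) (n : nat) :
  nbhs x [set y : cantor_space | forall i, (i < n)%N -> y i = x i].
Proof.
elim: n => [|n IH]; first by apply: filterS filterT.
have : nbhs x ((fun y : cantor_space => y n) @^-1` [set x n]).
  apply: (@proj_continuous nat (fun=> bool) n x).
  by rewrite nbhs_principalE.
move: IH; apply: filterS2 => y yx /= yn i.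
by rewrite ltnS leq_eqVlt => /predU1P[->|/yx].
Qed.

Definition disjoint_support (x y : nat -> bool) := forall i, ~~ (x i && y i).

(** The map sends x to the limit of [psum g x]. Uniform tail bounds give continuity, separation of
    partial sums gives injectivity, and additivity passes to the limit from [psum_or]. *)
Lemma cantor_additive_embedding (R : realType) (G : topologicalZmodType) :
  polish R G -> ~ countable [set: G] ->
  hausdorff_space G /\ exists phi : cantor_space -> G,
    [/\ injective phi, continuous phi &
        forall x y : nat -> bool, disjoint_support x y ->
          phi (fun i => x i || y i) = phi x + phi y].
Proof.
move=> [sepG [d [dm dT dC]]] uncG.
have hG : hausdorff_space G by exact: metric_hausdorff dm dT.
split=> //.
have n0 : ~ nbhs (0 : G) [set 0].
  by move=> n0; exact/uncG/separable_discrete_countable.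
have [g [e [g0 e_gt0 [e0 eS] ge sep]]] := digit_sequence R G d dm dT n0.
have [d_ge0 d_eq0 d_sym d_tri] := dm.
(* The increments telescope, because halving gives e n <= 2 * e n - 2 * e n.+1. *)
have tail x n k :
    d (psum g x n) (psum g x (n + k)%N) <= 2 * e n - 2 * e (n + k)%N.
  elim: k => [|k IH]; first by rewrite addn0 subrr (d_eq0 _ _).2.
  rewrite addnS psumS.
  have := eS (n + k)%N; have := e_gt0 (n + k)%N.
  case: (x (n + k)%N); last by rewrite addr0; lra.
  have := d_tri (psum g x n) (psum g x (n + k)%N)
    (psum g x (n + k)%N + g (n + k)%N).
  have := ge x (n + k)%N; lra.
have tail2 x n m : (n <= m)%N -> d (psum g x n) (psum g x m) < 2 * e n.
  move=> /subnKC <-; have := tail x n (m - n)%N; have := e_gt0 (n + (m - n))%N.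
  lra.
have e_small r : 0 < r -> exists n, e n < r.
  (* A crude consequence of halving, as (n + 2) / 2 <= n + 1, which still forces e n to 0. *)
  move=> r0; have e_le n : e n * n.+1%:R <= 1.
    elim: n => [|n IH]; first by rewrite e0 mul1r.
    apply: le_trans IH; have n_ge0 : 0 <= n%:R :> R by [].
    rewrite -[n.+2%:R]natr1 -[n.+1%:R]natr1.
    have := eS n; have := e_gt0 n; nra.
  pose n := Num.truncn r^-1; exists n.
  have rn : r^-1 < n.+1%:R by rewrite truncnS_gt.
  have := e_le n; rewrite -ler_pdivlMr ?ltr0n // => /le_lt_trans; apply.
  by rewrite div1r invf_plt ?posrE.
have limit x : {l : G | psum g x @ \oo --> l}.
  apply/cid/dC => r r0; have [N eN] := e_small (r / 4) ltac:(by rewrite divr_gt0).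
  exists N => m n Nm Nn.
  have := d_tri (psum g x m) (psum g x N) (psum g x n).
  by rewrite (d_sym _ (psum g x N)); have := tail2 x N m Nm;
    have := tail2 x N n Nn; lra.
pose phi x := sval (limit x).
have phi_cvg x : psum g x @ \oo --> phi x by exact: svalP (limit x).
(* The tail costs 2 * e n, and the distance of a late partial sum to the limit costs another e n. *)
have phi_near x n : d (psum g x n) (phi x) < 3 * e n.
  have : nbhs (phi x) [set y | d (phi x) y < e n] by apply/dT; exists (e n).
  move=> /(phi_cvg x)[N _ NP].
  have := NP (N + n)%N (leq_addr _ _) => /=.
  have := tail2 x n (N + n)%N (leq_addl _ _).
  have := d_tri (psum g x n) (psum g x (N + n)%N) (phi x).
  rewrite (d_sym (phi x)); lra.
exists phi; split.
- move=> x y xy; apply: contrapT => x_neq_y.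
  have ex_neq : exists n, x n != y n.
    apply: contrapT => noN; apply: x_neq_y; apply/funext => n.
    by apply: contra_notP noN => /eqP xyn; exists n.
  (* At the first difference n the partial sums still agree; one step later they differ by the
     nonzero digit g n. *)
  case: (ex_minnP ex_neq) => n xyn minn.
  have eq_n : psum g x n = psum g y n.
    apply: eq_psum => i; rewrite ltnNge => ni; apply/eqP.
    by apply: contraNT ni; exact: minn.
  have neqS : psum g x n.+1 != psum g y n.+1.
    rewrite !psumS eq_n (inj_eq (addrI _)).
    by case: (x n) (y n) xyn => [] [] //= _; rewrite ?g0 // eq_sym g0.
  have := sep x y n neqS; have := phi_near x n.+1.
  have := phi_near y n.+1; rewrite -xy.
  have := d_tri (psum g x n.+1) (phi x) (psum g y n.+1).
  rewrite (d_sym (phi x)); lra.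
- move=> x A /dT[r r0 rA].
  have [n en] := e_small (r / 6) ltac:(by rewrite divr_gt0).
  apply: filterS (nbhs_cantor_prefix x n) => y /eq_psum yx; apply: rA => /=.
  have := d_tri (phi x) (psum g x n) (phi y).
  have := phi_near x n; have := phi_near y n; rewrite (yx _ g).
  rewrite (d_sym (phi x) (psum g x n)); lra.
- move=> x y xy.
  apply: (cvg_unique hG (phi_cvg (fun i => x i || y i))).
  rewrite (_ : psum _ _ = fun n => psum g x n + psum g y n); last first.
    by apply/funext => n; exact: psum_or.
  apply: (cvg_comp2 (phi_cvg x) (phi_cvg y)).
  exact: (@add_continuous G (phi x, phi y)).
Qed.

(** A violation is visible on finitely many coordinates. Hence [invisible_code] is phrased by pairs,
    not by the least element of the support. *)
Lemma closed_cantor_pairwise (r : nat -> nat -> Prop) :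
  closed [set x : cantor_space | forall m n, x m -> x n -> r m n].
Proof.
move=> x cx m n xm xn.
have [y /= [yr yx]] := cx _ (nbhs_cantor_prefix x (maxn m n).+1).
by apply: yr; rewrite yx // ltnS ?leq_maxl ?leq_maxr.
Qed.

(** * Disjoint families in sigma-finite sets *)

Lemma finite_large_disjoint (d : measure_display) (T : measurableType d)
    (R : realType) (mu : {measure set T -> \bar R}) (I : pointedType) (D : set I)
    (B : I -> set T) (F : set T) (e : R) :
  measurable F -> (mu F < +oo)%E -> 0 < e -> trivIset D B ->
  (forall i, D i ->
    [/\ measurable (B i), B i `<=` F & (e%:E <= mu (B i))%E]) ->
  finite_set D.
Proof.
move=> mF Ffin e0 trB BP; apply: contrapT.
move=> /infiniteP/pcard_leP/injfunPex[h h_fun h_inj].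
have hD n : D (h n) by exact: h_fun.
have mB n : measurable (B (h n)) by have [] := BP _ (hD n).
have trBh : trivIset setT (B \o h).
  by move=> m n _ _ mn; apply: h_inj; rewrite ?inE //;
    exact: trB (hD m) (hD n) mn.
(* The first n pieces are disjoint inside F; this bound fails once n exceeds mu F / e. *)
have le_F n : ((n%:R * e)%:E <= mu F)%E.
  rewrite (@le_trans _ _ (mu (\big[setU/set0]_(i < n) B (h i))))//; last first.
    apply: le_measure; rewrite ?inE//; first exact: bigsetU_measurable.
    rewrite -(bigcup_mkord n (B \o h)) => t [i _].
    by have [_ + _] := BP _ (hD i); exact.
  rewrite (@measure_bigsetU _ _ _ mu (B \o h)) //=.
  rewrite mulr_natl -[n in _ *+ n]card_ord -sumr_const -sumEFin.
  by apply: lee_sum => i _; have [] := BP _ (hD i).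
have mu_fin : mu F \is a fin_num by rewrite ge0_fin_numE.
pose n := (Num.truncn (fine (mu F) / e)).+1.
have := le_F n; rewrite -(fineK mu_fin) lee_fin leNgt -ltr_pdivrMr //.
by rewrite truncnS_gt.
Qed.

(** If c were nonzero, each [A i] would meet some [F k] in measure at least 1 / (n + 1) for some n.
    For fixed k and n only finitely many i qualify, so D would be countable. *)
Lemma sigma_finite_uncountable_disjoint (d : measure_display)
    (T : measurableType d) (R : realType) (mu : {measure set T -> \bar R})
    (C : set T) (I : pointedType) (D : set I) (A : I -> set T) (c : \bar R) :
  sigma_finite C mu -> ~ countable D -> trivIset D A ->
  (forall i, D i -> [/\ measurable (A i), A i `<=` C & mu (A i) = c]) ->
  c = 0%E.
Proof.
move=> [F CE FP] uncD trA AP; apply: contra_notP uncD => c0.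
pose E (p : nat * nat) : set I :=
  [set i | D i /\ ((p.2.+1%:R^-1)%:E <= mu (A i `&` F p.1))%E].
have EP : D `<=` \bigcup_p E p.
  move=> i Di; have [mA AC Ac] := AP i Di.
  have [k mu0] : exists k, mu (A i `&` F k) != 0%E.
    apply: contrapT => all0; apply: c0; rewrite -Ac.
    apply: measure_negligible => //.
    have -> : A i = \bigcup_k (A i `&` F k).
      by rewrite -setI_bigcupr -CE; apply/esym/setIidPl.
    apply: negligible_bigcup => k; apply/negligibleP.
      by apply: measurableI => //; have [] := FP k.
    by apply: contra_notP all0 => /eqP muk; exists k.
  have mu_gt0 : (0 < mu (A i `&` F k))%E by rewrite lt0e mu0 measure_ge0.
  have mu_fin : mu (A i `&` F k) \is a fin_num.
    rewrite ge0_fin_numE //; have [mF] := FP k; apply: le_lt_trans.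
    by apply: le_measure; rewrite ?inE //; exact: measurableI.
  exists (k, Num.truncn (fine (mu (A i `&` F k)))^-1) => //; split=> //=.
  rewrite -(fineK mu_fin) lee_fin; rewrite -(fineK mu_fin) lte_fin in mu_gt0.
  by apply: ltW; rewrite fineK // invf_plt ?posrE // truncnS_gt.
apply: sub_countable (subset_card_le EP) _.
apply: bigcup_countable => // -[k n] _; apply: finite_set_countable.
have [mF Ffin] := FP k.
apply: (finite_large_disjoint _ _ _ mu _ _ (fun i => A i `&` F k) _ (n.+1%:R^-1)
  mF Ffin) => //.
  by apply: trivIset_setIr; apply: sub_trivIset trA => i [].
move=> i [Di le_mu]; have [mA _ _] := AP i Di; split=> //.
exact: measurableI.
Qed.

Lemma uncountable_bool_sequences : ~ countable [set: nat -> bool].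
Proof.
move=> /pcard_leTP/injPex[f f_inj].
(* Cantor's diagonal sequence; quantifying over all y with [f y = n] avoids an inverse of f. *)
pose x n := `[< forall y : nat -> bool, f y = n -> ~~ y n >].
have := erefl (x (f x)); rewrite {1}/x; case xfx : (x (f x)).
  by move=> /asboolP/(_ x erefl); rewrite xfx.
move=> /asboolP; apply => y /f_inj ->; rewrite ?inE //.
by rewrite xfx.
Qed.

Lemma compact_translate (G : topologicalZmodType) (A : set G) (g : G) :
  compact A -> compact [set x + g | x in A].
Proof.
apply: continuous_compact.
by apply: continuous_subspaceT; exact: addr_continuous.
Qed.

Lemma compact_borel (G : topologicalZmodType) (A : set G) :
  hausdorff_space G -> compact A -> measurable (A : set (borelType G)).
Proof.
move=> hG /(compact_closed hG) cA; rewrite -[A]setCK.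
apply: (@measurableC _ (borelType G)); apply: sub_sigma_algebra.
exact: closed_openC.
Qed.

(** * Combinatorics of the codes *)

Definition invisible_code : set cantor_space :=
  [set x | forall m n, x m -> x n -> (logn 2 n <= m)%N].

(** The strict [m < n] lets digit m be added with disjoint support, and class m.+1 stays free for
    [layer]. *)
Definition code_tail (m : nat) : set cantor_space :=
  [set x | forall n, x n -> (m < n)%N /\ (logn 2 n <= m)%N].

(* Every [n] with [logn 2 n = m] is [2 ^ m * (2 * k + 1)], and [n %/ 2 ^ m.+1]
   recovers [k]. *)
Definition layer (m : nat) (a : nat -> bool) : nat -> bool :=
  fun n => (logn 2 n == m) && a (n %/ 2 ^ m.+1)%N.

Lemma invisible_code_decomp x : invisible_code x ->
  exists m, code_tail m x \/
    exists y, [/\ code_tail m y, disjoint_support y (pred1 m) &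
      x = (fun n => y n || (n == m))].
Proof.
move=> xC; have [[n0 xn0]|x0] := pselect (exists n, x n); last first.
  (* The zero sequence has no least index but lies in every tail, so any m would do. *)
  by exists 0%N; left => n xn; case: x0; exists n.
have [m xm minm] := ex_minnP (ex_intro _ n0 xn0).
exists m; right; exists (fun n => x n && (n != m)); split.
- move=> n /andP[xn nm]; split; last exact: xC.
  by rewrite ltn_neqAle eq_sym nm minm.
- by move=> n /=; case: (n == m); rewrite ?andbF.
- by apply/funext => n; case: eqP => [->|]; rewrite ?xm ?andbT ?orbF.
Qed.

Lemma layer_disjoint m a x : code_tail m x -> disjoint_support x (layer m.+1 a).
Proof.
move=> xT n; apply/negP => /andP[/xT[_ le_m] /andP[/eqP n_log _]].
by rewrite n_log ltnn in le_m.
Qed.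

(** All classes in use are at most m.+1, and all indices are at least m.+1: those of the tail exceed
    m, those of the layer are multiples of 2 ^ m.+1. *)
Lemma layer_code m a x : code_tail m x ->
  invisible_code (fun n => x n || layer m.+1 a n).
Proof.
move=> xT i j xi xj.
have le_j : (logn 2 j <= m.+1)%N.
  by case/orP: xj => [/xT[_ /leqW]|/andP[/eqP ->]].
apply: leq_trans le_j _.
case/orP: xi => [/xT[]//|/andP[/eqP <- _]].
have [->|i0] := posnP i; first by rewrite logn0.
by apply: ltnW; apply: leq_trans (ltn_expl _ _) (dvdn_leq i0 (pfactor_dvdnn 2 i)).
Qed.

(** Tails vanish on class m.+1, so a and b can be read off there. *)
Lemma layer_inj m a b x y : code_tail m x -> code_tail m y ->
  (fun n => x n || layer m.+1 a n) = (fun n => y n || layer m.+1 b n) -> a = b.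
Proof.
move=> xT yT xy; apply/funext => k.
pose n := (2 ^ m.+1 * k.*2.+1)%N.
have n_log : logn 2 n = m.+1.
  rewrite lognM ?expn_gt0 // pfactorK // lognE /=.
  by rewrite dvdn2 /= odd_double /= addn0.
have n_div : (n %/ 2 ^ m.+2 = k)%N.
  by rewrite (expnSr 2 m.+1) divnMl ?expn_gt0 // divn2 /= uphalf_double.
have := congr1 (@^~ n) xy; rewrite /layer n_log n_div eqxx /=.
have notT z : code_tail m z -> z n = false.
  by move=> zT; apply/negP => /zT[_]; rewrite n_log ltnn.
by rewrite !notT.
Qed.

Theorem theorem4p2 (R : realType) (G : topologicalZmodType)
    (G_polish : polish R G) (G_uncountable : ~ countable [set: G]) :
  exists C : set G, [/\ C !=set0, compact C & strongly_invisible R C].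
Proof.
have [hG [phi [phi_inj phi_cont phiD]]] :=
  cantor_additive_embedding R G G_polish G_uncountable.
have phi_compact A : closed A -> compact (phi @` A).
  move=> cA; apply: continuous_compact; first exact: continuous_subspaceT.
  exact: (subclosed_compact cA cantor_space_compact).
have cC : compact (phi @` invisible_code).
  apply: phi_compact.
  exact: (closed_cantor_pairwise (fun m n => logn 2 n <= m)%N).
have cT m : compact (phi @` code_tail m).
  apply: phi_compact.
  (* The dummy index i gives the condition its pairwise form; taking i = n removes it. *)
  rewrite (_ : code_tail m = [set x : cantor_space |
    forall i n, x i -> x n -> (m < n)%N /\ (logn 2 n <= m)%N]).
    exact: (closed_cantor_pairwise
      (fun _ n => (m < n)%N /\ (logn 2 n <= m)%N)).
  apply/seteqP; split=> x xT; first by move=> i n _; exact: xT.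
  by move=> n xn; exact: (xT n n).
exists (phi @` invisible_code); split=> //.
  by exists (phi (fun=> false)), (fun=> false).
split=> [|mu mu_inv]; first exact: compact_borel.
(* The disjunction reduces to proving C null when it is sigma-finite. *)
apply/or_asboolP; rewrite -implyNb; apply/implyP => /asboolPn muC0.
apply/asboolP => sfC; apply: muC0.
have mTg m g : measurable
    ([set x + g | x in phi @` code_tail m] : set (borelType G)).
  by apply: compact_borel hG _; apply: compact_translate; exact: cT.
have muT m : mu (phi @` code_tail m) = 0%E.
  (* One translate of T_m for each bit sequence a: disjoint by [layer_inj], inside C by
     [layer_code], and of equal measure by invariance. *)
  pose A a := [set x + phi (layer m.+1 a) | x in phi @` code_tail m].
  apply: (sigma_finite_uncountable_disjoint _ (borelType G) R mu _ _ setT A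
    _ sfC uncountable_bool_sequences).
    move=> a b _ _ [_ /= [[_ [x xT <-] <-] [_ [y yT <-]]]].
    rewrite -!phiD; do ?exact: layer_disjoint.
    by move=> /phi_inj/esym; exact: layer_inj.
  move=> a _; split; first exact: mTg.
    move=> _ [_ [x xT <-] <-]; rewrite -phiD; last exact: layer_disjoint.
    by exists (fun n => x n || layer m.+1 a n) => //; exact: layer_code.
  by apply: mu_inv; exact: compact_borel hG (cT m).
(* Here [phi (pred1 m)] stands for the digit g_m; both pieces are null by [muT] and invariance. *)
pose E m : set G :=
  phi @` code_tail m `|` [set x + phi (pred1 m) | x in phi @` code_tail m].
have CE : phi @` invisible_code `<=` \bigcup_m E m.
  move=> _ [x /invisible_code_decomp[m xT] <-]; exists m => //.
  case: xT => [xT|[y [yT ym ->]]]; first by left; exists x.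
  by right; exists (phi y); [exists y|rewrite -phiD].
apply: (@measure_negligible _ (borelType G) R mu); first exact: compact_borel.
apply: (@negligibleS _ (borelType G) R mu _ _ CE).
apply: negligible_bigcup => m.
apply: negligibleU; apply/negligibleP.
- exact: compact_borel hG (cT m).
- exact: muT.
- exact: mTg.
- by rewrite -[RHS](muT m); apply: mu_inv; exact: compact_borel hG (cT m).
Qed.
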